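(* Let $R$ be an integral domain with integral closure $R'$ in $\mathrm{qf}(R)$, and suppose that $R$ is a maximal non pseudo-valuation subring of $\mathrm{qf}(R)$. If $R$ is local, then the following are equivalent: (i) $R$ is a maximal non valuative domain. (ii) $R$ is not valuative, and $R$ has a unique minimal overring $S$ that is a valuative pseudo-valuation domain with associated valuation overring $R'$.
   Context: All rings are commutative with identity and are integral domains; $\mathrm{qf}(R)$ denotes the quotient field of $R$. A local ring is a ring with a unique maximal ideal (not necessarily Noetherian). An overring of $R$ is a subring of $\mathrm{qf}(R)$ containing $R$; it is proper if it is different from $R$. An integral domain $R$ is a valuative domain if for each nonzero $x\in \mathrm{qf}(R)$, at least one of the extensions $R\subseteq R[x]$ and $R\subseteq R[x^{-1}]$ has no ring strictly between its two ends (equality of the two ends is allowed). An integral domain $R$ is a maximal non valuative domain if $R$ is not a valuative domain but every proper overring of $R$ is a valuative domain. A domain $R$ is a pseudo-valuation domain if for every prime ideal $P$ of $R$ and all $x,y\in\mathrm{qf}(R)$ with $xy\in P$, either $x\in P$ or $y\in P$. Such a domain is local, and its (canonically) associated valuation overring is the valuation overring having the same maximal ideal as the domain itself (every prime ideal of the domain is then also a prime ideal of that overring). A proper subring $R$ of a domain $T$ is a maximal non pseudo-valuation subring of $T$ if $R$ is not a pseudo-valuation domain but each subring of $T$ properly containing $R$ is a pseudo-valuation domain. A proper overring $S$ of a domain $R$ is called the unique minimal overring of $R$ if every proper overring of $R$ contains $S$. *)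

(* Defs.v *)
From HB Require Import structures.
From mathcomp Require Import all_boot all_order all_algebra.
From mathcomp Require Import boolp classical_sets.
Set Implicit Arguments.
Unset Strict Implicit.
Unset Printing Implicit Defensive.
Import GRing.Theory.
Local Open Scope ring_scope.
Local Open Scope classical_set_scope.

(* The domains that occur are subrings of                                     *)
(* an ambient field K, given as sets D : set K with subring D; the predicates *)
(* below are only meaningful for such D.  The quotient field of D is          *)
(* realised inside K as the set of quotients of elements of D.                *)

Section Domains.
Variable K : fieldType.
Implicit Types (A B C D E I M P S T V : set K) (x y : K).

Definition subring D : Prop := subring_closed (mem D).

Definition qf D : set K := [set x | exists a b, [/\ D a, D b, b != 0 & x = a / b]].

Definition overring D E : Prop := [/\ subring E, D `<=` E & E `<=` qf D].

Definition proper_overring D E : Prop := overring D E /\ E <> D.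

Definition ideal D I : Prop :=
  [/\ I `<=` D, I 0, (forall x y, I x -> I y -> I (x + y))
    & (forall x y, D x -> I y -> I (x * y))].

Definition prime_ideal D P : Prop :=
  [/\ ideal D P, P <> D
    & forall x y, D x -> D y -> P (x * y) -> P x \/ P y].

Definition maximal_ideal D M : Prop :=
  [/\ ideal D M, M <> D
    & forall I, ideal D I -> M `<=` I -> I = M \/ I = D].

Definition unique_maximal_ideal D M : Prop :=
  maximal_ideal D M /\ forall N, maximal_ideal D N -> N = M.

Definition local_ring D : Prop := exists M, unique_maximal_ideal D M.

Definition adjoin D x : set K :=
  [set y | exists p : {poly K}, p \is a polyOver (mem D) /\ y = p.[x]].

Definition no_ring_strictly_between A B : Prop :=
  forall C, subring C -> A `<=` C -> C `<=` B -> C = A \/ C = B.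

Definition valuative D : Prop :=
  forall x, qf D x -> x != 0 ->
    no_ring_strictly_between D (adjoin D x) \/
    no_ring_strictly_between D (adjoin D x^-1).

Definition maximal_non_valuative D : Prop :=
  ~ valuative D /\ forall E, proper_overring D E -> valuative E.

Definition pseudo_valuation D : Prop :=
  forall P, prime_ideal D P ->
    forall x y, qf D x -> qf D y -> P (x * y) -> P x \/ P y.

Definition valuation_ring V : Prop :=
  forall x, qf V x -> x != 0 -> V x \/ V x^-1.

Definition associated_valuation_overring D V : Prop :=
  [/\ overring D V, valuation_ring V
    & exists M, unique_maximal_ideal D M /\ unique_maximal_ideal V M].

Definition maximal_non_pseudo_valuation_subring D T : Prop :=
  [/\ subring D, D `<=` T, D <> T, ~ pseudo_valuation D
    & forall E, subring E -> D `<=` E -> E <> D -> E `<=` T ->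
        pseudo_valuation E].

Definition unique_minimal_overring D S : Prop :=
  proper_overring D S /\ forall E, proper_overring D E -> S `<=` E.

End Domains.

(* An abstract domain R, as a subring of its field of fractions. *)
Definition in_frac (R : idomainType) : set {fraction R} := range (@tofrac R).
Arguments in_frac R : clear implicits.

Definition integral_closure (R : idomainType) : set {fraction R} :=
  [set x | integralOver (@tofrac R) x].
Arguments integral_closure R : clear implicits.

(* Main.v *)
(** Every proper overring of R is a pseudo-valuation domain, hence local, and
    this forces V = R' to be a valuation ring: if neither x nor 1/x lies in V,
    then V[x] is local, so x or 1 + x is a unit of V[x], whose inverse is then
    integral over V.  Let N be the maximal ideal of V.  Every overring E <> R
    inside V contains N, while R does not (otherwise R would be a
    pseudo-valuation domain), and S = R + N is the unique minimal overring: an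
    overring E not inside V with E meeting V in R only is excluded by
    Nakayama's lemma applied to R[n] for some n in N outside R.

    Conversely, an overring of S not contained in V contains V.  For S in E in
    V with common maximal ideal M, everything takes place in the algebraic
    extension of k = S/M by V/M, all of whose simple subextensions are minimal.
    If k[a] is a proper subfield, the primitive element theorem fails for a and
    any b outside k[a]; hence the characteristic is p > 0 and V/M has exponent
    p over k.  So simple extensions of E/M = F in V/M have degree 1 or p, and
    again nothing lies strictly between F and F[u]. *)
From HB Require Import structures.
Require Import Defs.
From mathcomp Require Import all_boot all_order all_algebra all_solvable all_field.
From mathcomp Require Import boolp classical_sets.
Set Implicit Arguments.
Unset Strict Implicit.
Unset Printing Implicit Defensive.
Import GRing.Theory.
Local Open Scope ring_scope.
Local Open Scope classical_set_scope.

(** * Subrings of a field *)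

Section Subrings.
Variable K : fieldType.
Implicit Types (A B C D E I M N P : set K) (x y z : K) (p q : {poly K}).

Lemma mem_memE D x : (x \in mem D) = D x :> Prop.
Proof. exact: in_setE. Qed.

Lemma subringP D : subring D <->
  [/\ D 1, forall x y, D x -> D y -> D (x - y)
    & forall x y, D x -> D y -> D (x * y)].
Proof.
rewrite /subring /subring_closed mem_memE; split=> -[h1 hB hM]; split=> // x y.
- by move=> hx hy; rewrite -mem_memE; apply: hB; rewrite mem_memE.
- by move=> hx hy; rewrite -mem_memE; apply: hM; rewrite mem_memE.
- by rewrite !mem_memE; apply: hB.
- by rewrite !mem_memE; apply: hM.
Qed.

Lemma subring1 D : subring D -> D 1.
Proof. by case/subringP. Qed.
Lemma subringB D x y : subring D -> D x -> D y -> D (x - y).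
Proof. by case/subringP=> _ h _; apply: h. Qed.
Lemma subringM D x y : subring D -> D x -> D y -> D (x * y).
Proof. by case/subringP=> _ _; apply. Qed.
Lemma subring0 D : subring D -> D 0.
Proof. by move=> h; rewrite -(subrr 1); apply: subringB => //; apply: subring1. Qed.
Lemma subringN D x : subring D -> D x -> D (- x).
Proof. by move=> h hx; rewrite -sub0r; apply: subringB => //; apply: subring0. Qed.
Lemma subringD D x y : subring D -> D x -> D y -> D (x + y).
Proof. by move=> h hx hy; rewrite -[y]opprK; apply: subringB => //; apply: subringN. Qed.
Lemma subringX D x n : subring D -> D x -> D (x ^+ n).
Proof.
move=> h hx; elim: n => [|n ih]; first exact: subring1.
by rewrite exprS; apply: subringM.
Qed.
Lemma subring_sum D (J : Type) (r : seq J) (Q : pred J) (F : J -> K) :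
  subring D -> (forall i, Q i -> D (F i)) -> D (\sum_(i <- r | Q i) F i).
Proof.
move=> h hF; apply: (big_ind D) => //; first exact: subring0.
by move=> x y; apply: subringD.
Qed.

Lemma subringI A B : subring A -> subring B -> subring (A `&` B).
Proof.
move=> hA hB; apply/subringP; split; first by split; apply: subring1.
- by move=> x y [? ?] [? ?]; split; apply: subringB.
- by move=> x y [? ?] [? ?]; split; apply: subringM.
Qed.

Lemma polyOver_memP D p :
  subring D -> p \is a polyOver (mem D) <-> forall i, D p`_i.
Proof.
move=> hD; split=> [/(all_nthP 0) h i|h]; last first.
  by apply/(all_nthP 0) => i _; rewrite mem_memE.
have [/h|/(nth_default 0)->] := ltnP i (size p); last exact: subring0.
by rewrite mem_memE.
Qed.

Lemma horner_subring D p x : subring D -> (forall i, D p`_i) -> D x -> D p.[x].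
Proof.
move=> h hp hx; rewrite horner_coef; apply: subring_sum => // i _.
by apply: subringM => //; apply: subringX.
Qed.

Lemma adjoinP D x y : subring D ->
  adjoin D x y <-> exists p, (forall i, D p`_i) /\ y = p.[x].
Proof.
by move=> hD; split=> -[p [hp ->]]; exists p; split=> //; apply/polyOver_memP.
Qed.

Lemma adjoin_sub D x : subring D -> D `<=` adjoin D x.
Proof.
move=> h y hy; apply/(adjoinP _ _ h); exists y%:P; split; last by rewrite hornerC.
by move=> i; rewrite coefC; case: ifP => // _; apply: subring0.
Qed.

Lemma adjoin_gen D x : subring D -> adjoin D x x.
Proof.
move=> h; apply/(adjoinP _ _ h); exists 'X; split; last by rewrite hornerX.
by move=> i; rewrite coefX; case: eqP => _; [apply: subring1|apply: subring0].
Qed.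

Lemma adjoin_subring D x : subring D -> subring (adjoin D x).
Proof.
move=> h; apply/subringP; split; first by apply: adjoin_sub => //; apply: subring1.
- move=> y z /(adjoinP _ _ h)[p [hp ->]] /(adjoinP _ _ h)[q [hq ->]].
  apply/(adjoinP _ _ h); exists (p - q); split; last by rewrite !hornerE.
  by move=> i; rewrite coefB; apply: subringB.
- move=> y z /(adjoinP _ _ h)[p [hp ->]] /(adjoinP _ _ h)[q [hq ->]].
  apply/(adjoinP _ _ h); exists (p * q); split; last by rewrite !hornerE.
  by move=> i; rewrite coefM; apply: subring_sum => // j _; apply: subringM.
Qed.

Lemma adjoin_min D C x : subring C -> D `<=` C -> C x -> adjoin D x `<=` C.
Proof.
move=> hC hDC hx y [p [hp ->]].
refine (horner_subring hC _ hx).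
apply/(polyOver_memP _ hC); apply: polyOverS hp => t.
by rewrite !mem_memE; apply: hDC.
Qed.

Lemma adjoin_id D x : subring D -> D x -> adjoin D x = D.
Proof.
move=> h hx; apply/seteqP; split; last exact: adjoin_sub.
exact: adjoin_min.
Qed.

(** Integrality of [x] over [D], phrased with a set of coefficients so that the base ring can vary
    among the subrings of [K]. *)
Definition monic_root D x :=
  exists p, [/\ p \is monic, forall i, D p`_i & root p x].

Lemma monic_root_sub D E x : D `<=` E -> monic_root D x -> monic_root E x.
Proof. by move=> DE [p [? hp ?]]; exists p; split=> // i; apply: DE. Qed.

(** Multiplying z^-1 = p(z) by a power of z^-1 gives a monic equation for z^-1, whose lower
    coefficients are those of -p in reverse order. *)
Lemma monic_root_inv D z :
  subring D -> z != 0 -> adjoin D z z^-1 -> monic_root D z^-1.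
Proof.
move=> h z0 /(adjoinP _ _ h)[p [hp e]].
pose n := size p; pose q := \poly_(i < n) p`_(n.-1 - i).
have szq : (size (- q) < size ('X^n : {poly K}))%N.
  by rewrite size_polyN size_polyXn ltnS; apply: size_poly.
exists ('X^n - q); split.
- by rewrite monicE lead_coefDl // lead_coefXn.
- move=> i; rewrite coefB coefXn coef_poly; apply: subringB => //.
    by case: eqP => _; [apply: subring1|apply: subring0].
  by case: ifP => // _; apply: subring0.
rewrite rootE !hornerE horner_poly subr_eq0; apply/eqP.
have n0 : (0 < n)%N.
  rewrite /n lt0n size_poly_eq0; apply/eqP => p0.
  by move/eqP: e; rewrite p0 horner0 invr_eq0 (negbTE z0).
rewrite -{1}(prednK n0) exprSr {2}e horner_coef mulr_sumr.
rewrite (reindex_inj rev_ord_inj) /=; apply: eq_bigr => i _.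
have le_in : (i <= n.-1)%N by rewrite -ltnS (prednK n0).
have -> : (size p - i.+1 = n.-1 - i)%N by rewrite subnS -subn1 subnAC subn1.
rewrite mulrCA; congr (_ * _).
rewrite -{1}(subnK le_in) exprD mulrAC -exprMn mulVf // expr1n.
by rewrite mul1r.
Qed.

(** Dividing the monic equation of [x], of degree n + 1, by x^n expresses [x] as a polynomial in
    x^-1. *)
Lemma monic_root_adjoin_inv D x :
  subring D -> x != 0 -> monic_root D x -> adjoin D x^-1 x.
Proof.
move=> h x0 [p [mp hp rp]].
have szp : (1 < size p)%N.
  by apply: (root_size_gt1 _ rp); rewrite monic_neq0.
pose n := (size p).-2; have szE : size p = n.+2.
  by rewrite /n; case: (size p) szp => [|[]].
apply/(adjoinP _ _ h); exists (- \poly_(i < n.+1) p`_(n - i)); split.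
  move=> i; rewrite coefN coef_poly; apply: subringN => //.
  by case: ifP => // _; apply: subring0.
rewrite hornerN horner_poly.
move: rp mp; rewrite rootE monicE lead_coefE szE horner_coef szE big_ord_recr /=.
move=> /eqP e /eqP lc; move: e; rewrite lc mul1r addrC => /eqP.
rewrite addr_eq0 => /eqP e.
have xE : x = x ^+ n.+1 * x^-1 ^+ n.
  by rewrite exprS -mulrA -exprMn mulfV // expr1n mulr1.
rewrite [LHS]xE e mulNr mulr_suml; congr (- _).
rewrite (reindex_inj rev_ord_inj) /=; apply: eq_bigr => i _.
have le_in : (i <= n)%N by rewrite -ltnS.
rewrite subSS -mulrA; congr (_ * _).
have -> : x^-1 ^+ n = x^-1 ^+ (n - i) * x^-1 ^+ i by rewrite -exprD subnK.
by rewrite mulrA -exprMn mulfV // expr1n mul1r.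
Qed.

End Subrings.

(** * Local domains and pseudo-valuation domains *)

Section Local.
Variable K : fieldType.
Implicit Types (A B C D E I J M N P Q X : set K) (x y z : K) (p q : {poly K}).

Lemma ideal_not1 D I : subring D -> ideal D I -> I <> D -> ~ I 1.
Proof.
move=> hD [ID I0 Iadd Imul] neq I1; apply: neq; apply/seteqP; split=> // x Dx.
by rewrite -[x]mulr1; apply: Imul.
Qed.

Lemma idealB D I x y : subring D -> ideal D I -> I x -> I y -> I (x - y).
Proof.
move=> hD [ID I0 Iadd Imul] Ix Iy; apply: Iadd => //; rewrite -mulN1r.
by apply: Imul => //; apply: subringN => //; apply: subring1.
Qed.

Lemma maximal_ideal_exists D I :
  subring D -> ideal D I -> ~ I 1 -> exists M, maximal_ideal D M /\ I `<=` M.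
Proof.
move=> hD hI I1; have [ID I0 Iadd Imul] := hI.
(* Joining [I] to [X] inside the predicate makes [set0] satisfy it, as the empty chain in Zorn's
   lemma requires. *)
pose P X := ideal D (X `|` I) /\ ~ (X `|` I) 1.
have P0 : P set0 by rewrite /P set0U.
have [F FP Fchain|A [[hA A1] Amax]] := @Zorn_bigcup _ P.
  (* Adding the empty set to the chain avoids treating the empty chain apart. *)
  pose F' X := F X \/ X = set0.
  have F'P X : F' X -> P X by case=> [/FP|->].
  have F'sub X : F' X -> X `|` I `<=` \bigcup_(X in F) X `|` I.
    by case=> [FX x [Xx|]|-> x [|]]; by [right|left; exists X|].
  have memF' x y : (\bigcup_(X in F) X `|` I) x -> (\bigcup_(X in F) X `|` I) y ->
      exists X, [/\ F' X, (X `|` I) x & (X `|` I) y].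
    case=> [[X FX Xx]|Ix] [[Y FY Yy]|Iy].
    - have [XY|YX] := Fchain _ _ FX FY.
      + by exists Y; split; [left|left; apply: XY|left].
      + by exists X; split; [left|left|left; apply: YX].
    - by exists X; split; [left|left|right].
    - by exists Y; split; [left|right|left].
    - by exists set0; split; [right|right|right].
  split; last first.
    by move=> h; have [X [/F'P[_ n1] h1 _]] := memF' _ _ h h.
  split.
  - by move=> x h; have [X [/F'P[[XD _ _ _] _] h1 _]] := memF' _ _ h h; apply: XD.
  - by right.
  - move=> x y hx hy; have [X [FX h1 h2]] := memF' _ _ hx hy.
    by have [[_ _ XA _] _] := F'P _ FX; apply: (F'sub _ FX); apply: XA.
  - move=> x y Dx hy; have [X [FX h1 _]] := memF' _ _ hy hy.
    by have [[_ _ _ XM] _] := F'P _ FX; apply: (F'sub _ FX); apply: XM.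
exists (A `|` I); split; last by move=> x; right.
split=> // [E|J hJ sAJ]; first by apply: A1; rewrite E; apply: subring1.
have [J1|J1] := pselect (J 1).
  by right; apply: contrapT => /(ideal_not1 hD hJ).
left; have JI : J `|` I = J.
  by apply/seteqP; split=> [x [//|Ix]|x]; [apply: sAJ; right|left].
apply/seteqP; split=> // x Jx; left; apply: contrapT => nAx.
apply: (Amax J); last by rewrite /P JI.
by split=> [y Ay|/(_ x Jx)//]; apply: sAJ; left.
Qed.

Lemma maximal_ideal_prime D M :
  subring D -> maximal_ideal D M -> prime_ideal D M.
Proof.
move=> hD [hM MD Mmax]; have [sMD M0 Madd Mmul] := hM.
split=> // x y Dx Dy Mxy; apply: contrapT => /not_orP[nMx nMy].
pose J z := exists m r, [/\ M m, D r & z = m + r * x].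
have sMJ : M `<=` J.
  by move=> m Mm; exists m, 0; rewrite mul0r addr0; split=> //; apply: subring0.
have Jx : J x by exists 0, 1; rewrite mul1r add0r; split=> //; apply: subring1.
have hJ : ideal D J.
  split.
  - move=> z [m [r [Mm Dr ->]]]; apply: subringD => //; first exact: sMD.
    exact: subringM.
  - exact: sMJ.
  - move=> z t [m [r [Mm Dr ->]]] [m' [r' [Mm' Dr' ->]]].
    exists (m + m'), (r + r'); split; [exact: Madd|exact: subringD|].
    by rewrite mulrDl addrACA.
  - move=> z t Dz [m [r [Mm Dr ->]]]; exists (z * m), (z * r).
    by split; [exact: Mmul|exact: subringM|rewrite mulrDr mulrA].
have [E|E] := Mmax J hJ sMJ; first by apply: nMx; rewrite -E.
have : J 1 by rewrite E; apply: subring1.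
case=> m [r [Mm Dr e]]; apply: nMy.
rewrite -[y]mul1r e mulrDl; apply: Madd; first by rewrite mulrC; apply: Mmul.
by rewrite -mulrA; apply: Mmul.
Qed.

Lemma nonunit_in_maximal D x : subring D -> D x -> ~ D x^-1 ->
  exists M, maximal_ideal D M /\ M x.
Proof.
move=> hD Dx nDx; pose I z := exists2 r, D r & z = r * x.
have hI : ideal D I.
  split.
  - by move=> z [r Dr ->]; apply: subringM.
  - by exists 0; rewrite ?mul0r //; apply: subring0.
  - move=> z t [r Dr ->] [r' Dr' ->]; exists (r + r'); first exact: subringD.
    by rewrite mulrDl.
  - by move=> z t Dz [r Dr ->]; exists (z * r); [exact: subringM|rewrite mulrA].
have [|M [hM IM]] := maximal_ideal_exists hD hI; last first.
  exists M; split=> //; apply: IM; exists 1; rewrite ?mul1r //.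
  exact: subring1.
case=> r Dr e; apply: nDx; have x0 : x != 0.
  by apply/eqP => x0; move/eqP: e; rewrite x0 mulr0 oner_eq0.
by have -> : x^-1 = r by rewrite -[r](mulfK x0) -e mul1r.
Qed.

(** A working form of locality: elements of [D] outside [M] are units, and [M], being proper,
    contains no unit, so [M] is the set of nonunits. *)
Definition nonunits_prime D M :=
  prime_ideal D M /\ forall x, D x -> ~ M x -> D x^-1.

Lemma prime_ideal_not1 D M : subring D -> prime_ideal D M -> ~ M 1.
Proof. by move=> hD [hM nMD _]; apply: ideal_not1 hD hM nMD. Qed.

Lemma local_nonunits_prime D :
  subring D -> local_ring D -> exists M, nonunits_prime D M.
Proof.
move=> hD [M [hM uM]]; exists M; split; first exact: maximal_ideal_prime.
move=> x Dx nMx; apply: contrapT => /(nonunit_in_maximal hD Dx)[N [hN Nx]].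
by apply: nMx; rewrite -(uM N hN).
Qed.

(** Suppose maximal ideals M and Q differ, with x in Q outside M and b in M outside Q. The
    pseudo-valuation property, applied to (x / b) b in Q and (b / x) x in M, puts x / b in Q and b /
    x in M; their product 1 then lies in Q. *)
Lemma pseudo_valuation_nonunits_prime D :
  subring D -> (forall x, qf D x) -> pseudo_valuation D ->
  exists M, nonunits_prime D M.
Proof.
move=> hD qfD pv; have h0 : ideal D [set 0].
  split=> //.
  - by move=> x ->; apply: subring0.
  - by move=> x y -> ->; rewrite /= addr0.
  - by move=> x y _ ->; rewrite /= mulr0.
have [|M [hM _]] := maximal_ideal_exists hD h0.
  by move/eqP; rewrite oner_eq0.
have pM := maximal_ideal_prime hD hM.
exists M; split=> // x Dx nMx; apply: contrapT => nDx.
have [Q [hQ Qx]] := nonunit_in_maximal hD Dx nDx.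
have pQ := maximal_ideal_prime hD hQ.
have [[[_ M0 _ _] _ _] [[_ Q0 _ Qmul] _ _]] := (pM, pQ).
have [b [Mb nQb]] : exists b, M b /\ ~ Q b.
  apply: contrapT => h; have sMQ : M `<=` Q.
    by move=> b Mb; apply: contrapT => nQb; apply: h; exists b.
  have [hQi nQD _] := hQ.
  by case: hM => _ _ /(_ Q hQi sMQ)[E|//]; apply: nMx; rewrite -E.
have x0 : x != 0 by apply/eqP => E; apply: nMx; rewrite E.
have b0 : b != 0 by apply/eqP => E; apply: nQb; rewrite E.
have Qxb : Q (x / b).
  by have [|//|//] := pv Q pQ (x / b) b (qfD _) (qfD _); rewrite divfK.
have Mbx : M (b / x).
  by have [|//|//] := pv M pM (b / x) x (qfD _) (qfD _); rewrite divfK.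
apply: (prime_ideal_not1 hD pQ).
have -> : 1 = b / x * (x / b) by rewrite mulrA divfK // divff.
by apply: Qmul => //; case: pM => [[sMD _ _ _] _ _]; apply: sMD.
Qed.

(** The conditions of being nonzero exclude the convention 0^-1 = 0, under which [D x^-1] alone
    would not make [x] a unit. *)
Lemma unit_or_unit_1B D M x : subring D -> nonunits_prime D M -> D x ->
  (x != 0 /\ D x^-1) \/ (1 - x != 0 /\ D (1 - x)^-1).
Proof.
move=> hD [pM hM] Dx; have [[_ M0 Madd _] _ _] := pM.
have [Mx|nMx] := pselect (M x); last first.
  by left; split; [apply/eqP => E; apply: nMx; rewrite E|exact: hM].
have n1 : ~ M (1 - x).
  move=> h; apply: (prime_ideal_not1 hD pM); rewrite -[1](subrK x).
  exact: Madd.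
right; split; first by apply/eqP => E; apply: n1; rewrite E.
by apply: hM => //; apply: subringB => //; apply: subring1.
Qed.

Lemma unique_maximal_nonunits D I : subring D -> ideal D I -> ~ I 1 ->
  (forall x, D x -> ~ I x -> D x^-1) -> unique_maximal_ideal D I.
Proof.
move=> hD hI I1 hinv; have [sID I0 Iadd Imul] := hI.
have big J : ideal D J -> J <> D -> J `<=` I.
  move=> hJ nJ x Jx; apply: contrapT => nIx.
  have [sJD _ _ Jmul] := hJ; apply: (ideal_not1 hD hJ nJ).
  have x0 : x != 0 by apply/eqP => E; apply: nIx; rewrite E.
  rewrite -(mulVf x0); apply: Jmul => //; apply: hinv => //; exact: sJD.
have nID : I <> D by move=> E; apply: I1; rewrite E; apply: subring1.
have mI : maximal_ideal D I.
  split=> // J hJ sIJ; have [->|nJ] := pselect (J = D); first by right.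
  by left; apply/seteqP; split=> //; apply: big.
split=> // N [hN nN Nmax].
by have [|//] := Nmax I hI (big N hN nN).
Qed.

(* Induction on the monic polynomial p, weakening p(x) = 0 to p(x) in M: write
   p(x) = q(x) x + c; if c is not in M, then x q(x) = p(x) - c is a unit, and
   otherwise q(x) x is in M, hence q(x) is. *)
Lemma pseudo_valuation_monic_root_inv E M x :
  subring E -> (forall x, qf E x) -> pseudo_valuation E ->
  nonunits_prime E M -> monic_root E x -> ~ M x -> adjoin E x x^-1.
Proof.
move=> hE qfE pv [pM hM] [p [mp Ep rp]] nMx.
have [iM _ _] := pM; have [sME M0 Madd Mmul] := iM.
have {rp} : M p.[x] by rewrite (rootP rp).
elim/poly_ind: p mp Ep => [|q c IH] mp Ep Mp.
  by move: mp; rewrite monicE lead_coef0 eq_sym oner_eq0.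
have Ec : E c by have := Ep 0%N; rewrite coefD coefMX coefC eqxx add0r.
have Eq i : E q`_i by have := Ep i.+1; rewrite coefD coefMX coefC /= addr0.
have [q0|q0] := eqVneq q 0.
  exfalso; move: mp Mp; rewrite q0 mul0r add0r monicE lead_coefC hornerC.
  by move=> /eqP-> M1; apply: (prime_ideal_not1 hE pM).
have mq : q \is monic.
  move: mp; rewrite !monicE lead_coefDl ?lead_coefMX //.
  rewrite size_mulX // (leq_ltn_trans (size_polyC_leq1 c)) //.
  by rewrite ltnS size_poly_gt0.
rewrite !hornerE in Mp.
have [Mc|nMc] := pselect (M c).
  apply: IH => //; have : M (q.[x] * x).
    by rewrite -[q.[x] * x](addrK c); apply: (idealB hE iM).
  by move/(pv M pM _ _ (qfE _) (qfE _)) => [|//].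
set m := q.[x] * x + c in Mp.
have nMmc : ~ M (m - c).
  move=> h; apply: nMc; have -> : c = m - (m - c) by rewrite subKr.
  by apply: (idealB hE iM).
have Emc : E (m - c) by apply: subringB => //; apply: sME.
have mcE : m - c = q.[x] * x by rewrite /m addrK.
have x0 : x != 0 by apply/eqP => e; apply: nMx; rewrite e.
have q0x : q.[x] != 0 by apply/eqP => e; apply: nMmc; rewrite mcE e mul0r.
have -> : x^-1 = q.[x] * (m - c)^-1 by rewrite mcE invfM mulrA divff ?mul1r.
have hA := adjoin_subring x hE.
apply: subringM => //; first by apply/(adjoinP _ _ hE); exists q.
by apply: adjoin_sub => //; apply: hM.
Qed.

End Local.

(** * Nakayama's lemma for a simple integral extension of a local ring *)

Section Nakayama.
Variables (K : fieldType) (D : set K) (n : K).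
Hypothesis hD : subring D.
Implicit Types (p q : {poly K}).

(** The [D]-module D[n] is generated by 1, n, ..., n^(j-1). *)
Let spanned j := forall p, (forall i, D p`_i) ->
  exists q, [/\ forall i, D q`_i, (size q <= j)%N & q.[n] = p.[n]].

Let spanned_step j (p q : {poly K}) :
  (forall i, D q`_i) -> (size q <= j)%N -> n ^+ j = q.[n] ->
  (forall i, D p`_i) -> (size p <= j.+1)%N ->
  exists p', [/\ forall i, D p'`_i, (size p' <= j)%N & p'.[n] = p.[n]].
Proof.
move=> Dq szq e Dp szp; exists (take_poly j p + p`_j *: q); split.
- move=> i; rewrite coefD coefZ coef_take_poly; apply: subringD => //.
    by case: ifP => // _; apply: subring0.
  exact: subringM.
- rewrite (leq_trans (size_polyD _ _)) // geq_max size_take_poly.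
  by rewrite (leq_trans (size_scale_leq _ _)).
- rewrite hornerD hornerZ -e [in RHS](horner_coef_wide _ szp) big_ord_recr /=.
  by rewrite horner_poly.
Qed.

(** The monic equation of degree d writes n^d as g(n) with g of degree less than d; multiplying by
    X^k rewrites n^(d+k), so the excess degree can be removed one step at a time. *)
Lemma monic_root_reduce : monic_root D n ->
  exists j, forall p, (forall i, D p`_i) ->
    exists q, [/\ forall i, D q`_i, (size q <= j.+1)%N & q.[n] = p.[n]].
Proof.
move=> [f [mf Df rf]].
have szf : (1 < size f)%N by apply: (root_size_gt1 _ rf); rewrite monic_neq0.
pose d := (size f).-1; have d0 : (0 < d)%N by rewrite /d -ltnS prednK // ltnW.
have szfE : size f = d.+1 by rewrite /d prednK // ltnW.
have fd : f`_d = 1 by apply/eqP; rewrite -monicE.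
pose g := - take_poly d f.
have Dg i : D g`_i.
  rewrite coefN coef_take_poly; apply: subringN => //.
  by case: ifP => // _; apply: subring0.
have szg : (size g <= d)%N by rewrite size_polyN size_take_poly.
have ge : n ^+ d = g.[n].
  apply/eqP; rewrite hornerN -addr_eq0 horner_poly addrC -{1}[n ^+ d]mul1r -fd.
  rewrite -(big_ord_recr d (fun i => f`_i * n ^+ i)) /= -szfE -horner_coef.
  by rewrite -rootE.
exists d.-1; rewrite prednK // => p.
have [k szp] : exists k, (size p <= d + k)%N.
  by exists (size p); rewrite leq_addl.
elim: k p szp => [|k IH] p szp Dp; first by exists p; split=> //; rewrite -[d]addn0.
have [|||||p' [Dp' szp' <-]] := @spanned_step (d + k) p (g * 'X^k).
- move=> i; rewrite coefMXn; case: ifP => // _; exact: subring0.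
- by rewrite (leq_trans (size_polyMleq _ _)) // size_polyXn addnS /= leq_add2r.
- by rewrite hornerM hornerXn -ge exprD.
- by [].
- by rewrite -addnS.
exact: IH.
Qed.

(** The hypothesis reads D[n] = D + c D[n], so D[n]/D is a finite module equal to c times itself.
    The proof removes the generators n^j one at a time, from the highest down, until 1 alone spans
    D[n]. *)
Lemma nakayama_adjoin M c : nonunits_prime D M -> M c -> monic_root D n ->
  (forall y, adjoin D n y ->
     exists r z, [/\ D r, adjoin D n z & y = r + c * z]) -> D n.
Proof.
move=> [pM hM] Mc rn hA; have [[sMD M0 Madd Mmul] _ _] := pM.
have [j] := monic_root_reduce rn; rewrite -/(spanned j.+1); elim: j => [|j IH] hj.
  have [|q [Dq szq e]] := hj 'X.
    by move=> i; rewrite coefX; case: eqP => _; [apply: subring1|apply: subring0].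
  by rewrite -[n]hornerX -e (size1_polyC szq) hornerC.
apply: IH => p Dp.
have [p2 [Dp2 szp2 <-]] := hj p Dp.
have nj : adjoin D n (n ^+ j.+1).
  by apply: subringX; [exact: adjoin_subring|exact: adjoin_gen].
have [r [z [Dr /(adjoinP _ _ hD)[pz [Dpz ->]] e]]] := hA _ nj.
have [s [Ds szs es]] := hj pz Dpz; rewrite -es in e.
(* In n^(j+1) = r + c s(n), collecting the terms in n^(j+1) leaves it with coefficient [u], a unit
   because [c] is in [M]; dividing by [u] expresses n^(j+1) through lower powers. *)
pose u := 1 - c * s`_j.+1.
have Dc : D c by apply: sMD.
have nMu : ~ M u.
  move=> Mu; apply: (prime_ideal_not1 hD pM).
  rewrite -[1](subrK (c * s`_j.+1)); apply: Madd => //.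
  by rewrite mulrC; apply: Mmul.
have u0 : u != 0 by apply/eqP => E; apply: nMu; rewrite E.
have Du : D u^-1.
  apply: hM => //; apply: subringB => //; first exact: subring1.
  exact: subringM.
apply: (@spanned_step _ p2 (u^-1 *: (r%:P + c *: take_poly j.+1 s))) => //.
- move=> i; rewrite coefZ coefD coefZ coefC coef_take_poly.
  apply: subringM => //; apply: subringD => //.
    by case: ifP => // _; apply: subring0.
  by apply: subringM => //; case: ifP => // _; apply: subring0.
- rewrite (leq_trans (size_scale_leq _ _)) // (leq_trans (size_polyD _ _)) //.
  rewrite geq_max (leq_trans (size_polyC_leq1 _)) //.
  by rewrite (leq_trans (size_scale_leq _ _)) // size_take_poly.
- rewrite hornerZ hornerD hornerC hornerZ horner_poly.
  apply: (canRL (mulKf u0)); rewrite {1}/u mulrBl mul1r {1}e.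
  rewrite (horner_coef_wide _ szs) big_ord_recr /= mulrDr addrA.
  by rewrite [c * (s`_j.+1 * _)]mulrA addrK.
Qed.

End Nakayama.

(** * The integral closure and the minimal overring *)

Section Closure.
Variable K : fieldType.
Implicit Types (D E M N P S V : set K) (x y z : K).

Lemma qf_sub D E x : D `<=` E -> qf D x -> qf E x.
Proof. by move=> s [a [b [Da Db b0 ->]]]; exists a, b; split=> //; apply: s. Qed.

(* The disjunct x = 0 is needed because 0^-1 = 0. *)
Definition valuation_nonunits V : set K := [set x | x = 0 \/ ~ V x^-1].

Lemma valuation_nonunits_sub V : (forall x : K, x != 0 -> V x \/ V x^-1) ->
  subring V -> valuation_nonunits V `<=` V.
Proof.
move=> val hV x [->|nVx]; first exact: subring0.
have [->|x0] := eqVneq x 0; first exact: subring0.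
by case: (val x x0).
Qed.

Lemma valuation_nonunits_ideal V : (forall x : K, x != 0 -> V x \/ V x^-1) ->
  subring V -> ideal V (valuation_nonunits V).
Proof.
move=> val hV; split; [exact: valuation_nonunits_sub|by left| |].
- move=> x y [->|nx]; first by rewrite add0r.
  case=> [->|ny]; first by rewrite addr0; right.
  have x0 : x != 0.
    by apply/eqP => E; apply: nx; rewrite E invr0; apply: subring0.
  have y0 : y != 0.
    by apply/eqP => E; apply: ny; rewrite E invr0; apply: subring0.
  have [->|s0] := eqVneq (x + y) 0; [by left|right] => Vs.
  (* Whichever of x / y and y / x lies in [V] turns an inverse of x + y into one of y or of x. *)
  have [V1|V1] := val (x / y) (mulf_neq0 x0 (invr_neq0 y0)).
    apply: ny; have -> : y^-1 = (x / y + 1) * (x + y)^-1.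
      by rewrite -(divff y0) -mulrDl mulrAC divff // mul1r.
    by apply: subringM => //; apply: subringD => //; apply: subring1.
  apply: nx; have -> : x^-1 = (1 + (x / y)^-1) * (x + y)^-1.
    by rewrite invf_div -(divff x0) -mulrDl mulrAC divff // mul1r.
  by apply: subringM => //; apply: subringD => //; apply: subring1.
- move=> a x Va [->|nx]; first by left; rewrite mulr0.
  have [->|s0] := eqVneq (a * x) 0; [by left|right] => Vs; apply: nx.
  move: s0; rewrite mulf_eq0 negb_or => /andP[a0 x0].
  have -> : x^-1 = a * (a * x)^-1 by rewrite invfM mulrA divff ?mul1r.
  exact: subringM.
Qed.

Lemma valuation_nonunits_not1 V : subring V -> ~ valuation_nonunits V 1.
Proof.
move=> hV [/eqP|]; first by rewrite oner_eq0.
by rewrite invr1 => h; apply: h; apply: subring1.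
Qed.

(** An inverse that is integral over [D] lies in D[x], which is [D] itself. *)
Lemma integral_unit D V x : subring D -> (forall x, V x -> monic_root D x) ->
  D x -> V x^-1 -> D x^-1.
Proof.
move=> hD hVD Dx /hVD rx; have [x0|x0] := eqVneq x 0.
  by rewrite x0 invr0 -x0.
rewrite -(adjoin_id hD Dx) -{1}[x]invrK.
by apply: monic_root_adjoin_inv => //; rewrite invr_eq0.
Qed.

(** Let N be the maximal ideal of [V]. A prime P of [D] lies in N, since units of [V] in [D] are
    units of [D]. If uv is in P and u is not in [D], then u^-1 is in [V], so v = u^-1 (uv) is in N;
    and v^2 = (u^-1 v)(uv) is in P because u^-1 v is in N, hence in [D]. So v is in P. *)
Lemma pseudo_valuation_of_valuation_ideal D V : subring D -> D `<=` V ->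
  subring V -> (forall x : K, x != 0 -> V x \/ V x^-1) ->
  (forall x, V x -> monic_root D x) ->
  valuation_nonunits V `<=` D -> pseudo_valuation D.
Proof.
move=> hD sDV hV val hVD sND P pP x y _ _ Pxy.
have [iP _ Pprime] := pP; have [sPD P0 Padd Pmul] := iP.
have [_ _ _ Nmul] := valuation_nonunits_ideal val hV.
have sPN p : P p -> valuation_nonunits V p.
  move=> Pp; have [->|p0] := eqVneq p 0; [by left|right] => Vp.
  apply: (prime_ideal_not1 hD pP); rewrite -(mulVf p0); apply: Pmul => //.
  by apply: integral_unit Vp => //; apply: sPD.
have key u v : P (u * v) -> ~ D u -> P u \/ P v.
  move=> Puv nDu; right.
  have u0 : u != 0 by apply/eqP => E; apply: nDu; rewrite E; apply: subring0.
  have vE : v = u^-1 * (u * v) by rewrite mulKf.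
  have Vu' : V u^-1 by apply: contrapT => h; apply: nDu; apply: sND; right.
  have Nv : valuation_nonunits V v by rewrite vE; apply: Nmul => //; apply: sPN.
  have : P (v * v).
    have -> : v * v = (u^-1 * v) * (u * v) by rewrite mulrACA mulVf // mul1r.
    by apply: Pmul => //; apply: sND; apply: Nmul.
  by move=> /Pprime[|//|//|//]; apply: sND.
have [Dx|nDx] := pselect (D x); last exact: key.
have [Dy|nDy] := pselect (D y); first exact: Pprime.
by rewrite mulrC in Pxy; apply/or_comm; apply: key.
Qed.

End Closure.

Section MaximalNonPV.
Variables (K : fieldType) (D V : set K).
Hypotheses (hD : subring D) (hV : subring V).
Hypothesis qfD : forall x, qf D x.
Hypothesis VE : forall x, V x <-> monic_root D x.
Hypothesis Vclosed : forall x, monic_root V x -> V x.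
Hypothesis hpv : forall E, subring E -> D `<=` E -> E <> D -> pseudo_valuation E.
Hypothesis npv : ~ pseudo_valuation D.
Hypothesis hloc : local_ring D.

Let sDV : D `<=` V.
Proof.
move=> x Dx; apply/VE; exists ('X - x%:P); split; last by rewrite root_XsubC.
  exact: monicXsubC.
move=> i; rewrite coefB coefX coefC; apply: subringB => //.
  by case: eqP => _; [apply: subring1|apply: subring0].
by case: eqP => // _; apply: subring0.
Qed.

Let overring_nonunits E : subring E -> D `<=` E -> E <> D ->
  exists M, nonunits_prime E M.
Proof.
move=> hE sDE nE; apply: pseudo_valuation_nonunits_prime => //.
  by move=> x; apply: qf_sub (qfD x).
exact: hpv.
Qed.

(** If neither x nor 1/x is in [V], then V[x] is a proper overring of [D], hence local, and -x or 1
    + x is a unit of it. The inverse of that unit is integral over [V], hence in [V]. *)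
Lemma closure_valuation x : x != 0 -> V x \/ V x^-1.
Proof.
move=> x0; have [M hM] : exists M, nonunits_prime V M.
  (* [hpv] speaks of proper overrings only, so the case V = D rests on the locality of [D]. *)
  have [->|nVD] := pselect (V = D); first exact: local_nonunits_prime.
  exact: overring_nonunits.
apply: contrapT => /not_orP[nVx nVx'].
have hE := adjoin_subring x hV.
have sVE := @adjoin_sub _ V x hV.
have Ex := adjoin_gen x hV.
have [ME hME] : exists ME, nonunits_prime (adjoin V x) ME.
  apply: overring_nonunits => //; first exact: subset_trans sVE.
  by move=> E; apply/nVx/sDV; rewrite -E.
have EN : adjoin V x (- x) by apply: subringN.
have [[_ Ex']|[y0 Ey]] := unit_or_unit_1B hE hME EN.
  apply/nVx'/Vclosed/monic_root_inv => //.
  by rewrite -[x^-1]opprK -invrN; apply: subringN.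
rewrite opprK in y0 Ey; have Vy : V (1 + x)^-1.
  apply/Vclosed/monic_root_inv => //.
  apply: adjoin_min Ey => //; first exact: adjoin_subring.
    exact: adjoin_sub.
  have : adjoin V (1 + x) (1 + x - 1); last by rewrite [1 + x - 1]addrAC subrr add0r.
  have hA : subring (adjoin V (1 + x)) by apply: adjoin_subring.
  by apply: subringB => //; [exact: adjoin_gen|exact: subring1].
(* With y = 1/(1 + x) in the local ring [V], either y is a unit and x = 1/y - 1, or 1 - y is a unit
   and 1/x = y/(1 - y). *)
have [[_ Vy']|[z0 Vz]] := unit_or_unit_1B hV hM Vy.
  apply: nVx; have -> : x = (1 + x)^-1^-1 - 1.
    by rewrite invrK addrAC subrr add0r.
  by apply: subringB => //; apply: subring1.
apply: nVx'; have -> : x^-1 = (1 + x)^-1 * (1 - (1 + x)^-1)^-1.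
  by rewrite -invfM mulrBr mulr1 mulfV // addrAC subrr add0r.
exact: subringM.
Qed.

Let N := valuation_nonunits V.
Let hN : ideal V N.
Proof. exact: valuation_nonunits_ideal closure_valuation hV. Qed.

(** [E] is a pseudo-valuation domain over which [V] is integral. An element x of [V] outside the
    maximal ideal of [E] therefore has its inverse in E[x], inside [V], and cannot be in [N]. *)
Lemma closure_nonunits_sub E :
  subring E -> D `<=` E -> E `<=` V -> E <> D -> N `<=` E.
Proof.
move=> hE sDE sEV nE x Nx; have [M hM] := overring_nonunits hE sDE nE.
have [Mx|nMx] := pselect (M x).
  by case: hM => -[[sME _ _ _] _ _] _; apply: sME.
have Vx : V x by case: hN => sNV _ _ _; apply: sNV.
case: Nx => [->|[]]; first exact: subring0.
apply: (adjoin_min hV sEV Vx).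
apply: pseudo_valuation_monic_root_inv nMx => //.
- by move=> z; apply: qf_sub (qfD z).
- exact: hpv.
- by apply: monic_root_sub sDE _; apply/VE.
Qed.

Let S : set K := [set x | exists d n, [/\ D d, N n & x = d + n]].

Let hS : subring S.
Proof.
have [sNV N0 Nadd Nmul] := hN.
apply/subringP; split.
- by exists 1, 0; rewrite addr0; split=> //; apply: subring1.
- move=> x y [d [n [Dd Nn ->]]] [d' [n' [Dd' Nn' ->]]]; exists (d - d'), (n - n').
  by split; [exact: subringB|exact: idealB hN _ _|rewrite addrACA opprD].
- move=> x y [d [n [Dd Nn ->]]] [d' [n' [Dd' Nn' ->]]].
  exists (d * d'), (d * n' + (d' + n') * n); split; first exact: subringM.
    apply: Nadd; apply: Nmul => //; first exact: sDV.
    by apply: subringD; [|exact: sDV|exact: sNV].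
  by rewrite mulrDl mulrDr -addrA [n * _]mulrC.
Qed.

Let sDS : D `<=` S.
Proof.
by move=> d Dd; exists d, 0; rewrite addr0; split=> //; case: hN.
Qed.

Let sNS : N `<=` S.
Proof. by move=> n Nn; exists 0, n; rewrite add0r; split=> //; apply: subring0. Qed.

Let sSV : S `<=` V.
Proof.
move=> x [d [n [Dd Nn ->]]]; apply: subringD => //; first exact: sDV.
by case: hN => sNV _ _ _; apply: sNV.
Qed.

Let not_sND : ~ N `<=` D.
Proof.
move=> sND; apply: npv; apply: pseudo_valuation_of_valuation_ideal sND => //.
  exact: closure_valuation.
by move=> x /VE.
Qed.

Let nSD : S <> D.
Proof. by move=> E; apply: not_sND => x /sNS; rewrite E. Qed.

(* If E contained some y outside V, one may take y to be a unit of E, so that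
   c = 1/y is a nonunit of D.  For n in N outside D, the ring D + c D[n] is a
   proper overring inside V, so it contains N and hence D[n]. *)
Let escape E : subring E -> D `<=` E -> E `&` V = D -> E `<=` V.
Proof.
move=> hE sDE EV y0 Ey0; apply: contrapT => nVy0.
have [n [Nn nDn]] : exists n, N n /\ ~ D n.
  apply: contrapT => h; apply: not_sND => n Nn; apply: contrapT => nDn.
  by apply: h; exists n.
have [sNV _ _ _] := hN.
have [M hM] : exists M, nonunits_prime E M.
  by apply: overring_nonunits => // E'; apply/nVy0/sDV; rewrite -E'.
have [y [yn0 Ey nVy Ey']] : exists y, [/\ y != 0, E y, ~ V y & E y^-1].
  have [[a b]|[a b]] := unit_or_unit_1B hE hM Ey0.
    by exists y0.
  exists (1 - y0); split=> //; first by apply: subringB => //; apply: subring1.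
  move=> h; apply: nVy0; rewrite -[y0](subKr 1); apply: subringB => //.
  exact: subring1.
pose c := y^-1.
have Vc : V c by case: (closure_valuation yn0).
have Dc : D c by rewrite -EV.
have nDc' : ~ D c^-1 by rewrite invrK => /sDV.
have [MD hMD] := local_nonunits_prime hD hloc.
have MDc : MD c by apply: contrapT => h; apply: nDc'; apply: hMD.2.
have Vn := sNV _ Nn.
have rn : monic_root D n by apply/VE.
pose A := adjoin D n; have hA : subring A := adjoin_subring n hD.
have sDA : D `<=` A by apply: adjoin_sub.
have sAV : A `<=` V by apply: adjoin_min.
pose C x := exists r z, [/\ D r, A z & x = r + c * z].
have hC : subring C.
  apply/subringP; split.
  - exists 1, 0; rewrite mulr0 addr0; split=> //; [exact: subring1|exact: subring0].
  - move=> u v [r [z [Dr Az ->]]] [r' [z' [Dr' Az' ->]]].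
    exists (r - r'), (z - z'); split; [exact: subringB|exact: subringB|].
    by rewrite mulrBr opprD addrACA.
  - move=> u v [r [z [Dr Az ->]]] [r' [z' [Dr' Az' ->]]].
    exists (r * r'), (r * z' + r' * z + c * (z * z')); split.
    + exact: subringM.
    + by do !apply: subringD => //; do !apply: subringM => //; apply: sDA.
    + by rewrite mulrDl !mulrDr -!addrA !mulrA [r * c]mulrC [c * z * r']mulrAC
        [c * r']mulrC [c * z * c]mulrAC.
have sDC : D `<=` C.
  move=> r Dr; exists r, 0; rewrite mulr0 addr0; split=> //; exact: subring0.
have sCV : C `<=` V.
  move=> u [r [z [Dr Az ->]]]; apply: subringD => //; first exact: sDV.
  by apply: subringM => //; apply: sAV.
(* If c n were in [D], then n = y (c n) would be in E and in [V], hence in [D]. *)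
have nCD : C <> D.
  move=> E1; have : D (c * n).
    rewrite -E1; exists 0, n; rewrite add0r; split=> //; first exact: subring0.
    exact: adjoin_gen.
  move=> /sDE Ecn; apply: nDn; rewrite -EV; split=> //.
  by rewrite -[n](mulVKf yn0); apply: subringM.
have Cn : C n by apply: (closure_nonunits_sub hC).
by apply: nDn; apply: (nakayama_adjoin hD hMD MDc rn); apply: (adjoin_min hC sDC Cn).
Qed.

(** Minimality is tested on the intersection of [E] with [V]: if it is [D], then [escape] gives E =
    D; otherwise it is a proper overring inside [V] and contains [N]. Integrality of [V] over D + N
    makes [N] the set of nonunits of both rings. *)
Lemma unique_minimal_overring_of_closure : exists S0,
  unique_minimal_overring D S0 /\ associated_valuation_overring S0 V.
Proof.
have [sNV _ _ Nmul] := hN.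
exists S; split.
  split; first by split=> //; split=> // x _.
  move=> E [[hE sDE _] nE].
  have [EV|nEV] := pselect (E `&` V = D).
    have sEV := escape hE sDE EV; case: nE; rewrite -EV.
    by apply/seteqP; split=> [x Ex|x []//]; split=> //; apply: sEV.
  have hEV := subringI hE hV.
  have sNE : N `<=` E.
    apply: (@subset_trans _ (E `&` V)); last by move=> x [].
    apply: (closure_nonunits_sub hEV) => //.
    by move=> x Dx; split; [exact: sDE|exact: sDV].
  by move=> x [d [n [Dd Nn ->]]]; apply: subringD; [|exact: sDE|exact: sNE].
split.
- by split=> // x _; apply: qf_sub (qfD x).
- by move=> x _; apply: closure_valuation.
exists N; split; apply: unique_maximal_nonunits => //.
- split; [exact: sNS|by case: hN|by case: hN|].
  by move=> x y Sx Ny; apply: Nmul => //; apply: sSV.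
- exact: valuation_nonunits_not1.
- move=> x Sx nNx; apply: (@integral_unit _ S V) => //.
    by move=> z /VE; apply: monic_root_sub.
  by apply: contrapT => h; apply: nNx; right.
- exact: valuation_nonunits_not1.
- by move=> x Vx nNx; apply: contrapT => h; apply: nNx; right.
Qed.

End MaximalNonPV.

(** * Residue fields *)

Section SubfieldType.
Variables (L : fieldType) (S : divringClosed L).
Record subfield_type := SubfieldType { subfield_val : L; _ : subfield_val \in S }.
HB.instance Definition _ := [isSub for subfield_val].
HB.instance Definition _ := [Choice of subfield_type by <:].
HB.instance Definition _ := [SubChoice_isSubComUnitRing of subfield_type by <:].
HB.instance Definition _ :=
  [SubComUnitRing_isSubIntegralDomain of subfield_type by <:].
HB.instance Definition _ := [SubIntegralDomain_isSubField of subfield_type by <:].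
End SubfieldType.

(** Presents a subfield given as a set by a field type with an embedding, so that polynomial gcds
    and primitive element theorems over it become available. *)
Lemma subfieldW (L : fieldType) (k : set L) :
  subring k -> (forall x, k x -> k x^-1) ->
  exists (F : fieldType) (iota : {rmorphism F -> L}),
    forall x, k x <-> exists t, iota t = x.
Proof.
move=> hk hV; have kP : GRing.divring_closed (mem k).
  split.
  - by rewrite mem_memE; apply: subring1.
  - by move=> x y; rewrite !mem_memE; apply: subringB.
  - by move=> x y; rewrite !mem_memE => kx /hV; apply: subringM.
pose S : divringClosed L := HB.pack (fun x => x \in mem k)
  (GRing.isDivringClosed.Build L _ kP).
exists (subfield_type S), (val : {rmorphism subfield_type S -> L}) => x.
split=> [kx|[t <-]]; last first.
  by have : is_true (val t \in mem k) := valP t; rewrite mem_memE.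
have Sx : x \in S by have : is_true (x \in mem k) by rewrite mem_memE.
by exists (SubfieldType Sx).
Qed.

Section ResidueField.
Variables (K : fieldType) (V M : set K).
Hypotheses (hV : subring V) (hM : ideal V M) (M1 : ~ M 1).
Hypothesis Vinv : forall x, V x -> ~ M x -> V x^-1.

Let M0 : M 0. Proof. by case: hM. Qed.
Let MD x y : M x -> M y -> M (x + y). Proof. by case: hM => _ _ h _; apply: h. Qed.
Let MV x : M x -> V x. Proof. by case: hM => h _ _ _; apply: h. Qed.
Let MM x y : V x -> M y -> M (x * y). Proof. by case: hM => _ _ _; apply. Qed.
Let MN x : M x -> M (- x).
Proof. by move=> Mx; rewrite -sub0r; apply: idealB hM _ _. Qed.

(* The residue field is carried by a chosen system of representatives in V. *)
Definition residue_rep (x : K) : K := xget 0 [set y | V y /\ M (y - x)].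

Let repP x : V x -> V (residue_rep x) /\ M (residue_rep x - x).
Proof.
move=> Vx; apply: (xgetPex 0 (P := [set y | V y /\ M (y - x)])).
by exists x; split=> //; rewrite subrr.
Qed.

(** Congruent elements have the same set of candidates, so [xget] chooses the same one. *)
Let rep_eq x y : M (x - y) -> residue_rep x = residue_rep y.
Proof.
move=> Mxy; congr (xget 0 _); apply/seteqP; split=> z [Vz Mz]; split=> //.
  by rewrite -(subrKA x); apply: MD.
by rewrite -(subrKA y) -[y - x]opprB; apply: MD => //; apply: MN.
Qed.

Definition is_residue_rep : pred K :=
  fun x => `[< V x /\ residue_rep x = x >].

Record residue := Residue { residue_val : K; _ : is_residue_rep residue_val }.
HB.instance Definition _ := [isSub for residue_val].
HB.instance Definition _ := [Choice of residue by <:].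

Let repV x : is_residue_rep (residue_rep x) \/ ~ V x.
Proof.
have [Vx|] := pselect (V x); [left|by right]; apply/asboolP.
by have [Vr Mr] := repP Vx; split=> //; apply: rep_eq.
Qed.

Let rep0P : is_residue_rep (residue_rep 0).
Proof. by have [//|[]] := repV 0; apply: subring0. Qed.

(** Total on [K], with a default value where no representative is available; only its values on [V]
    are meaningful. *)
Definition residue_pi (x : K) : residue :=
  insubd (Residue rep0P) (residue_rep x).

Let val_pi x : V x -> val (residue_pi x) = residue_rep x.
Proof.
move=> Vx; rewrite /residue_pi val_insubd; have [->//|] := repV x.
by move=> /(_ Vx).
Qed.

Let pi_eq x y : V x -> V y -> M (x - y) -> residue_pi x = residue_pi y.
Proof. by move=> Vx Vy /rep_eq e; apply: val_inj; rewrite !val_pi. Qed.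

Let V_val (a : residue) : V (val a).
Proof. by have /asboolP[] := valP a. Qed.

Let val_piM x : V x -> M (val (residue_pi x) - x).
Proof. by move=> Vx; rewrite val_pi //; case: (repP Vx). Qed.

Let valK a : residue_pi (val a) = a.
Proof. by apply: val_inj; rewrite val_pi //; have /asboolP[] := valP a. Qed.

Let V0 := subring0 hV.
Let V1 := subring1 hV.
Let VD x y := @subringD K V x y hV.
Let VM x y := @subringM K V x y hV.
Let VN x := @subringN K V x hV.

Let add (a b : residue) := residue_pi (val a + val b).
Let mul (a b : residue) := residue_pi (val a * val b).
Let opp (a : residue) := residue_pi (- val a).
Let inv (a : residue) :=
  if a == residue_pi 0 then residue_pi 0 else residue_pi (val a)^-1.

Let piD x y : V x -> V y -> add (residue_pi x) (residue_pi y) = residue_pi (x + y).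
Proof.
move=> Vx Vy; apply: pi_eq; [exact: VD|exact: VD|].
by rewrite opprD addrACA; apply: MD; apply: val_piM.
Qed.

Let piM x y : V x -> V y -> mul (residue_pi x) (residue_pi y) = residue_pi (x * y).
Proof.
move=> Vx Vy; apply: pi_eq; [exact: VM|exact: VM|].
rewrite -(subrKA (val (residue_pi x) * y)) -mulrBr -mulrBl.
apply: MD; first by apply: MM => //; apply: val_piM.
by rewrite mulrC; apply: MM => //; apply: val_piM.
Qed.

Let piN x : V x -> opp (residue_pi x) = residue_pi (- x).
Proof.
move=> Vx; apply: pi_eq; [exact: VN|exact: VN|].
by rewrite -opprD; apply: MN; apply: val_piM.
Qed.

Let repW (P : residue -> Prop) :
  (forall x, V x -> P (residue_pi x)) -> forall a, P a.
Proof. by move=> h a; rewrite -(valK a); apply: h. Qed.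

Let addA : associative add.
Proof.
elim/repW=> x Vx; elim/repW=> y Vy; elim/repW=> z Vz.
by rewrite !piD ?addrA //; apply: VD.
Qed.
Let addC : commutative add.
Proof. by move=> a b; rewrite /add addrC. Qed.
Let add0 : left_id (residue_pi 0) add.
Proof. by elim/repW=> x Vx; rewrite piD // add0r. Qed.
Let addN : left_inverse (residue_pi 0) opp add.
Proof. by elim/repW=> x Vx; rewrite piN // piD ?addNr //; apply: VN. Qed.
Let mulA : associative mul.
Proof.
elim/repW=> x Vx; elim/repW=> y Vy; elim/repW=> z Vz.
by rewrite !piM ?mulrA //; apply: VM.
Qed.
Let mulC : commutative mul.
Proof. by move=> a b; rewrite /mul mulrC. Qed.
Let mul1 : left_id (residue_pi 1) mul.
Proof. by elim/repW=> x Vx; rewrite piM // mul1r. Qed.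
Let mulDl : left_distributive mul add.
Proof.
elim/repW=> x Vx; elim/repW=> y Vy; elim/repW=> z Vz.
by rewrite piD // !piM ?piD ?mulrDl //; [exact: VM|exact: VM|exact: VD].
Qed.

Let pi0P x : V x -> residue_pi x = residue_pi 0 <-> M x.
Proof.
move=> Vx; split=> [e|Mx]; last by apply: pi_eq => //; rewrite subr0.
have := val_piM Vx; rewrite e => h; have := val_piM V0; rewrite subr0 => h'.
by rewrite -[x](subKr (val (residue_pi 0))); apply: idealB hM _ _.
Qed.

Let one_neq0 : residue_pi 1 != residue_pi 0.
Proof. by apply/eqP => /(pi0P V1). Qed.

HB.instance Definition _ := GRing.isZmodule.Build residue addA addC add0 addN.
HB.instance Definition _ := GRing.Zmodule_isComNzRing.Build residue
  mulA mulC mul1 mulDl one_neq0.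

Let mulVx (a : residue) : a != 0 -> inv a * a = 1.
Proof.
move=> a0; rewrite /inv ifN //; move: a0; elim/repW: a => x Vx a0.
set b := residue_pi x; have nM : ~ M (val b).
  by move=> Mb; case/eqP: a0; rewrite -[LHS]valK; apply/pi0P.
have Vb := V_val b; have Vb' := Vinv Vb nM.
have -> : residue_pi (val b)^-1 * b = mul (residue_pi (val b)^-1) (residue_pi (val b)).
  by rewrite valK.
rewrite piM // mulVf //; apply/eqP => e; apply: nM; by rewrite e.
Qed.

Let inv0 : inv 0 = 0.
Proof. by rewrite /inv eqxx. Qed.

HB.instance Definition _ := GRing.ComNzRing_isField.Build residue mulVx inv0.

(** The interface to V/M: the later arguments use these properties and never the chosen
    representatives. *)
Lemma residue_fieldW : exists (L : fieldType) (pi : K -> L),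
  [/\ pi 1 = 1, {in V &, {morph pi : x y / x - y}},
      {in V &, {morph pi : x y / x * y}},
      forall x, V x -> pi x = 0 <-> M x
    & forall a, exists2 x, V x & pi x = a].
Proof.
exists (residue : fieldType), residue_pi; split=> //.
- move=> x y; rewrite !in_setE => Vx Vy; rewrite -piD; [|by []|exact: VN].
  by rewrite -piN.
- by move=> x y; rewrite !in_setE => Vx Vy; rewrite -piM.
- by move=> a; exists (val a).
Qed.

End ResidueField.

(** * Simple extensions and primitive elements *)

Section FinitePrimitive.
Variables (L : fieldType) (k : set L).
Hypothesis hk : subring k.
Hypothesis kalg : forall u : L, u != 0 -> adjoin k u u^-1.

Lemma all_roots (r : {poly L}) : r != 0 ->
  exists s : seq L, forall x, root r x -> x \in s.
Proof.
have [n] := ubnP (size r); elim: n r => // n IH r szr r0.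
have [[x rx]|nx] := pselect (exists x, root r x); last first.
  by exists [::] => x rx; case: nx; exists x.
have /factor_theorem[q rE] := rx.
have q0 : q != 0 by apply: contraNneq r0 => q0; rewrite rE q0 mul0r.
have [|s hs] := IH q _ q0.
  by move: szr; rewrite rE size_Mmonic ?monicXsubC // size_XsubC addn2.
exists (x :: s) => y; rewrite rE rootM root_XsubC inE => /orP[/hs->|->//].
by rewrite orbT.
Qed.

(** [u] is integral over the finite ring [k], so its powers are combinations of finitely many of
    them with coefficients in a finite set; by the pigeonhole principle two powers coincide. *)
Lemma finite_torsion (s : seq L) (u : L) : (forall x, k x -> x \in s) -> u != 0 ->
  exists2 n, (0 < n)%N & u ^+ n = 1.
Proof.
move=> ks u0; have ku : monic_root k u.
  rewrite -[u]invrK; apply: monic_root_inv => //; first by rewrite invr_eq0.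
  by apply: kalg; rewrite invr_eq0.
have [j hj] := monic_root_reduce hk ku.
pose T := {ffun 'I_j.+1 -> seq_sub s}.
have /choice[g hg] : forall i : nat, exists f : T,
    u ^+ i = \sum_(l < j.+1) ssval (f l) * u ^+ l.
  move=> i; have [|q [kq szq e]] := hj 'X^i.
    by move=> l; rewrite coefXn; case: eqP => _; [exact: subring1|exact: subring0].
  exists [ffun l : 'I_j.+1 => SeqSub (ks _ (kq l))].
  rewrite -[LHS]hornerXn -e (horner_coef_wide _ szq).
  by apply: eq_bigr => l _; rewrite ffunE.
have : ~~ injectiveb (fun i : 'I_#|{: T}|.+1 => g i).
  apply/injectiveP => inj; have := leq_card _ inj.
  by rewrite card_ord ltnn.
case/injectivePn=> a [b neq_ab].
move/(congr1 (fun f : T => \sum_(l < j.+1) ssval (f l) * u ^+ l)).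
rewrite -!hg => e.
wlog lt_ab : a b neq_ab e / (a < b)%N.
  move=> h; have [lt|lt|/val_inj eab] := ltngtP a b; first exact: h lt.
    by apply: h lt; rewrite // eq_sym.
  by rewrite eab eqxx in neq_ab.
exists (b - a)%N; first by rewrite subn_gt0.
apply: (mulfI (expf_neq0 a u0)); rewrite mulr1 -exprD subnKC //.
exact: ltnW.
Qed.

(** The products a^i b^j form a finite subgroup of the multiplicative group of a field, hence a
    cyclic one; z is a generator. *)
Lemma torsion_primitive (a b : L) n m : (0 < n)%N -> (0 < m)%N ->
  a ^+ n = 1 -> b ^+ m = 1 -> exists z i j, a = z ^+ i /\ b = z ^+ j.
Proof.
move=> n0 m0 an bm.
pose rs := undup [seq a ^+ i * b ^+ j | i <- iota 0 n, j <- iota 0 m].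
have rsP x : reflect (exists i j, x = a ^+ i * b ^+ j) (x \in rs).
  rewrite mem_undup; apply: (iffP allpairsP) => [[[i j] [_ _ ->]]|[i [j ->]]].
    by exists i, j.
  exists (i %% n, j %% m)%N; rewrite !mem_iota /= !ltn_mod n0 m0.
  by rewrite -[in LHS](expr_mod i an) -[in LHS](expr_mod j bm).
have nz_a : a != 0.
  by apply: contra_eq_neq an => ->; rewrite expr0n gtn_eqF // eq_sym oner_neq0.
have nz_b : b != 0.
  by apply: contra_eq_neq bm => ->; rewrite expr0n gtn_eqF // eq_sym oner_neq0.
have nz x : x \in rs -> x != 0.
  by case/rsP=> i [j ->]; rewrite mulf_neq0 // expf_neq0.
have rs1 : 1 \in rs by apply/rsP; exists 0%N, 0%N; rewrite !expr0 mulr1.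
have sz0 : (0 < size rs)%N by case: (rs) rs1.
have urs : uniq rs by apply: undup_uniq.
(* Multiplication by x permutes [rs]; comparing the products over [rs] before and after gives the
   equation. *)
have rsN x : x \in rs -> x ^+ size rs = 1.
  move=> rx; pose f y := x * y.
  have finj : injective f by apply: mulfI; apply: nz.
  have peq : perm_eq (map f rs) rs.
    apply: uniq_perm => //; first by rewrite map_inj_uniq.
    apply: (uniq_min_size _ _ _).2; rewrite ?map_inj_uniq ?size_map //.
    move=> _ /mapP[y ry ->]; case/rsP: rx => i [j ex]; case/rsP: ry => i' [j' ey].
    by apply/rsP; exists (i + i')%N, (j + j')%N; rewrite /f ex ey !exprD mulrACA.
  have : \prod_(y <- map f rs) y = \prod_(y <- rs) y by apply: perm_big.
  rewrite big_map big_split /= big_const_seq count_predT iter_mulr_1 => e.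
  have p0 : \prod_(y <- rs) y != 0.
    by rewrite prodf_seq_neq0; apply/allP => y /nz ->.
  by apply: (mulIf p0); rewrite mul1r.
have /hasP[z _ zprim] : has (size rs).-primitive_root rs.
  apply: has_prim_root => //; apply/allP => x /rsN e.
  exact/unity_rootP.
have ra : a \in rs by apply/rsP; exists 1%N, 0%N; rewrite expr1 expr0 mulr1.
have rb : b \in rs by apply/rsP; exists 0%N, 1%N; rewrite expr1 expr0 mul1r.
have [[i ->] [j ->]] := (prim_rootP zprim (rsN _ ra), prim_rootP zprim (rsN _ rb)).
by exists z, i, j.
Qed.

End FinitePrimitive.

Lemma map_poly_lift (F L : fieldType) (iota : {rmorphism F -> L}) (k : set L) :
  (forall x, k x <-> exists t, iota t = x) ->
  forall p : {poly L}, (forall i, k p`_i) -> exists q, map_poly iota q = p.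
Proof.
move=> kE p kp; have /choice[s hs] : forall x, exists t, k x -> iota t = x.
  move=> x; have [kx|nkx] := pselect (k x); last by exists 0.
  by have [t <-] := (kE x).1 kx; exists t.
exists (\poly_(i < size p) s p`_i); apply/polyP => i.
rewrite coef_map coef_poly; case: ltnP => [_|h]; first exact: hs.
by rewrite raddf0 nth_default.
Qed.

(* gcd(h, X^p - u^p) divides (X - u)^p, so it is (X - u)^m up to a constant, and
   if 0 < m < p its coefficient of degree m - 1 puts u into G. *)
Lemma expr_pchar_root (L : fieldType) (G : set L) (p : nat) (u : L) (h : {poly L}) :
  subring G -> (forall x, G x -> G x^-1) -> p \in [pchar L] -> G (u ^+ p) -> ~ G u ->
  (forall i, G h`_i) -> (size h <= p)%N -> h.[u] = 0 -> h = 0.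
Proof.
move=> hG GV pL Gup nGu Gh szh hu.
have [F [iota GE]] := subfieldW hG GV.
have [h0 h0E] := map_poly_lift GE Gh.
have [c cE] := (GE _).1 Gup.
have p0 : (0 < p)%N by apply: prime_gt0; apply: pcharf_prime pL.
pose g := gcdp h0 ('X^p - c%:P).
have gE : map_poly iota g = gcdp h (('X - u%:P) ^+ p).
  rewrite gcdp_map h0E rmorphB /= map_polyXn map_polyC /= cE; congr gcdp.
  have pP : p \in [pchar {poly L}] by rewrite pchar_poly.
  rewrite -[RHS](pFrobenius_autE pP) pFrobenius_autB_comm; last exact: mulrC.
  by rewrite !pFrobenius_autE polyC_exp.
apply/eqP/negPn/negP => hn0.
have rg : root (map_poly iota g) u.
  rewrite gE root_gcd !rootE hu eqxx horner_exp hornerXsubC subrr expr0n.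
  by rewrite gtn_eqF //= eqxx.
have : map_poly iota g %| ('X - u%:P) ^+ p by rewrite gE dvdp_gcdr.
move=> /dvdp_exp_XsubCP[m _ eqm].
have m0 : (0 < m)%N.
  rewrite lt0n; apply/eqP => E; move: rg; rewrite (eqp_root eqm) E expr0.
  by rewrite rootE hornerC oner_eq0.
have ltmp : (m < p)%N.
  rewrite (leq_trans _ szh) // -(size_exp_XsubC m u) -(eqp_size eqm) gE.
  exact/dvdp_leq/dvdp_gcdl.
have mon : map_poly iota ((lead_coef g)^-1 *: g) = ('X - u%:P) ^+ m.
  have gn0 : map_poly iota g != 0 by rewrite gE gcdp_eq0 negb_and hn0.
  have /eqpf_eq[c' c'0 e] := eqm.
  rewrite map_polyZ /= fmorphV -lead_coef_map e scalerA.
  rewrite lead_coefZ (monicP (monic_exp _ (monicXsubC u))) mulr1.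
  by rewrite mulVf // scale1r.
have := congr1 (fun q : {poly L} => q`_m.-1) mon; rewrite coef_map /= => e.
have e2 : (('X - u%:P) ^+ m)`_m.-1 = - (u *+ m).
  rewrite -(prednK m0) /= exprS mulrC; elim: (m.-1) => [|n IH].
    by rewrite expr0 mul1r coefB coefX coefC /= sub0r.
  rewrite exprSr mulrBr coefB coefMX /= IH coefMC.
  have -> : (('X - u%:P) ^+ n * ('X - u%:P))`_n.+1 = 1.
    rewrite -exprSr; have /monicP := monic_exp n.+1 (monicXsubC u).
    by rewrite lead_coefE size_exp_XsubC.
  by rewrite mul1r [in RHS]mulrSr opprD.
have mL : m%:R != 0 :> L.
  rewrite -(dvdn_pcharf pL); apply/negP => /dvdn_leq.
  by move=> /(_ m0); rewrite leqNgt ltmp.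
apply: nGu; have Gum : G (- (u *+ m)) by rewrite -e2 -e; apply/GE; eexists.
have -> : u = - - (u *+ m) / m%:R by rewrite opprK -[u *+ m]mulr_natr mulfK.
apply: subringM => //; first exact: subringN.
apply: GV; elim: (m) => [|i IH]; first exact: subring0.
by rewrite mulrS; apply: subringD => //; apply: subring1.
Qed.

(** * Algebraic extensions whose simple subextensions are all minimal *)

Section MinimalSimple.
Variables (L : fieldType) (k : set L).
Hypothesis hk : subring k.
Hypothesis kalg : forall u : L, u != 0 -> adjoin k u u^-1.
Hypothesis kmin : forall u v, adjoin k u v -> ~ k v -> adjoin k v u.

(** [kalg] makes [L] algebraic over [k], so every intermediate ring is a field. *)
Let over_inv G u : subring G -> k `<=` G -> G u -> G u^-1.
Proof.
move=> hG skG Gu; have [->|u0] := eqVneq u 0; first by rewrite invr0; apply: subring0.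
exact: (adjoin_min hG skG Gu (kalg u0)).
Qed.

(** Under [kmin] this relation is symmetric and means that [a] and [b] lie in no common simple
    extension of [k]; it is the obstruction to the primitive element theorem. *)
Let indep a b := ~ k a /\ ~ adjoin k a b.

Let indep_sym a b : indep a b -> indep b a.
Proof.
move=> [nka nab]; split; first by move=> kb; apply: nab; apply: adjoin_sub.
by move=> ba; apply: nab; apply: kmin.
Qed.

(** By [kmin], a in k[z] outside k generates all of k[z], so b would be in k[a]. *)
Let indep_nonprim a b z : indep a b -> adjoin k z a -> adjoin k z b -> False.
Proof.
move=> [nka nab] za zb; apply: nab.
apply: (adjoin_min (adjoin_subring a hk) _ _ zb); first exact: adjoin_sub.
exact: kmin.
Qed.

Let indep_neq0 a b : indep a b -> a != 0.
Proof. by move=> [nka _]; apply/eqP => a0; apply: nka; rewrite a0; apply: subring0. Qed.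

Section Lift.
Variables (F : fieldType) (iota : {rmorphism F -> L}).
Hypothesis kE : forall x, k x <-> exists t, iota t = x.

Let lift_in z w : (exists q, (map_poly iota q).[z] = w) -> adjoin k z w.
Proof.
move=> [q <-]; apply/(adjoinP _ _ hk); exists (map_poly iota q); split=> // i.
by rewrite coef_map; apply/kE; eexists.
Qed.

Let alg_root (u : L) : u != 0 -> exists2 q, q != 0 & root (map_poly iota q) u.
Proof.
move=> u0; have /(adjoinP _ _ hk)[p [kp e]] := kalg u0.
(* From u^-1 = q(u), the polynomial q X - 1 vanishes at u; its constant term -1 makes it nonzero. *)
have [q qE] := map_poly_lift kE kp; exists (q * 'X - 1).
  apply/eqP => /(congr1 (fun r : {poly F} => r`_0)); rewrite coefB coefMX coef1 coef0.
  by move/eqP; rewrite sub0r oppr_eq0 oner_eq0.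
by rewrite rootE rmorphB rmorphM rmorph1 /= map_polyX qE !hornerE -e mulVf // subrr.
Qed.

(** With b separable, any element of k that is not a root of a certain nonzero polynomial r yields a
    z generating both a and b, against [indep_nonprim]. *)
Let indep_separable a b q : indep a b ->
  root (map_poly iota q) b -> separable_poly q -> False.
Proof.
move=> iab rq sq; have [pa pa0 ra] := alg_root (indep_neq0 iab).
have [r r0 hr] := large_field_PET pa0 ra rq sq.
have [[t nrt]|h] := pselect (exists t, ~~ root r (iota t)).
  by have [za zb] := hr t nrt; apply: indep_nonprim iab (lift_in za) (lift_in zb).
(* Otherwise k is finite, and a and b are powers of a common root of unity. *)
have [s hs] := all_roots r0.
have ks x : k x -> x \in s.
  move/kE=> [t <-]; apply: hs; apply: contrapT => /negP nr; apply: h.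
  by exists t.
have [n n0 an] := finite_torsion hk kalg ks (indep_neq0 iab).
have [m m0 bm] := finite_torsion hk kalg ks (indep_neq0 (indep_sym iab)).
have [z [i [j [ea eb]]]] := torsion_primitive n0 m0 an bm.
have hz := adjoin_subring z hk.
by apply: (@indep_nonprim a b z iab); rewrite ?ea ?eb;
  apply: subringX => //; apply: adjoin_gen.
Qed.

Lemma indep_pchar_exists a b : indep a b -> exists p, p \in [pchar L].
Proof.
move=> iab; apply: contrapT => h.
have pF : [pchar F] =i pred0.
  move=> p; apply/negP => pF; apply: h; exists p.
  by rewrite (fmorph_pchar iota).
have [pa pa0 ra] := alg_root (indep_neq0 iab).
have [pb pb0 rb] := alg_root (indep_neq0 (indep_sym iab)).
have [n [za zb]] := pchar0_PET pa0 ra pb0 rb pF.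
exact: indep_nonprim iab (lift_in za) (lift_in zb).
Qed.

(** Were b^p outside k, [kmin] would put b in k[b^p] and make b separable over k. *)
Lemma indep_expr_pchar a b p : p \in [pchar L] -> indep a b -> k (b ^+ p).
Proof.
move=> pL iab; apply: contrapT => nkbp.
have kb : adjoin k b (b ^+ p).
  by apply: subringX; [exact: adjoin_subring|exact: adjoin_gen].
have /(adjoinP _ _ hk)[f [kf e]] := kmin kb nkbp.
have [f0 f0E] := map_poly_lift kE kf.
have pF : p \in [pchar F] by rewrite -(fmorph_pchar iota).
(* f expresses b as f(b^p), and X - f(X^p) has derivative 1. *)
apply: (@indep_separable a b ('X - (f0 \Po 'X^p))) => //.
  rewrite rootE rmorphB /= map_polyX map_comp_poly f0E map_polyXn.
  by rewrite !hornerE horner_comp hornerXn -e subrr.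
rewrite separable_poly.unlock derivB derivX deriv_comp derivXn -mulr_natr.
have -> : p%:R = 0 :> {poly F} by rewrite -polyC_natr (pcharf0 pF).
by rewrite !mulr0 subr0 coprimep1.
Qed.

End Lift.

(** For F = k this is [kmin]. Otherwise an element a of F outside k is independent of v, so p-th
    powers of all elements lie in k. If u were outside F[v], it would have degree p over F[v], yet v
    is a polynomial in u of degree less than p over F; that polynomial would be the constant v,
    putting v in F. *)
Lemma minimal_simple_extension F : subring F -> k `<=` F ->
  forall u v, adjoin F u v -> ~ F v -> adjoin F v u.
Proof.
move=> hF skF u v Fuv nFv.
have [[a [Fa nka]]|h] := pselect (exists a, F a /\ ~ k a); last first.
  have FE : F = k.
    apply/seteqP; split=> // x Fx; apply: contrapT => nkx; apply: h.
    by exists x.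
  by rewrite FE in Fuv nFv *; apply: kmin.
have [b iab] : exists b, indep a b.
  exists v; split=> // kav; apply: nFv.
  by apply: (adjoin_min hF skF Fa).
have [F0 [iota kE]] := subfieldW hk (fun x => @over_inv k x hk (@subset_refl _ k)).
have [p pL] := indep_pchar_exists kE iab.
(* An element w outside k is independent of a, or else lies in k[a] and is then independent of b. *)
have kp w : k (w ^+ p).
  have [kw|nkw] := pselect (k w); first exact: subringX.
  have [kaw|nkaw] := pselect (adjoin k a w); last first.
    by apply: (indep_expr_pchar kE pL (a := a)).
  apply: (indep_expr_pchar kE pL (a := b)); apply: indep_sym; split=> // kwb.
  apply: iab.2; apply: (adjoin_min (adjoin_subring a hk) _ kaw kwb).
  exact: adjoin_sub.
have hG := adjoin_subring v hF; have sFG := @adjoin_sub _ F v hF.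
apply: contrapT => nGu.
have /(adjoinP _ _ hF)[f [Ff e]] := Fuv.
have p0 : (0 < p)%N by apply: prime_gt0; apply: pcharf_prime pL.
(* fr is f reduced modulo X^p - u^p. *)
pose fr := \sum_(i < size f) (f`_i * (u ^+ p) ^+ (i %/ p)) *: 'X^(i %% p).
have Ffr i : F fr`_i.
  rewrite coef_sum; apply: subring_sum => // j _; rewrite coefZ coefXn.
  apply: subringM => //.
    by apply: subringM => //; apply: subringX => //; apply: skF.
  by case: eqP => _; [apply: subring1|apply: subring0].
have fru : fr.[u] = v.
  rewrite e horner_sum horner_coef; apply: eq_bigr => i _.
  by rewrite hornerZ hornerXn -mulrA -exprM -exprD mulnC -divn_eq.
have : fr - v%:P = 0.
  apply: (expr_pchar_root hG _ pL _ nGu) => //.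
  - by move=> x; apply: over_inv => //; apply: subset_trans sFG.
  - by apply: sFG; apply: skF.
  - move=> i; rewrite coefB coefC; apply: subringB => //; first exact: sFG.
    by case: eqP => _; [exact: adjoin_gen|exact: subring0].
  - rewrite (leq_trans (size_polyD _ _)) // geq_max size_polyN.
    rewrite (leq_trans (size_polyC_leq1 _)) // andbT.
    apply: (leq_trans (size_sum _ _ _)); apply/bigmax_leqP => i _.
    by rewrite (leq_trans (size_scale_leq _ _)) // size_polyXn ltn_mod.
  - by rewrite !hornerE fru subrr.
move/eqP; rewrite subr_eq0 => /eqP frE; apply: nFv.
by have := Ffr 0%N; rewrite frE coefC.
Qed.

End MinimalSimple.

(** * Overrings of a valuative pseudo-valuation domain *)

Section Residue.
Variables (K L : fieldType) (V M : set K) (pi : K -> L).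
Hypotheses (hV : subring V) (pi1 : pi 1 = 1).
Hypothesis piB : {in V &, {morph pi : x y / x - y}}.
Hypothesis piM : {in V &, {morph pi : x y / x * y}}.
Hypothesis pi0 : forall x, V x -> pi x = 0 <-> M x.
Implicit Types (A : set K) (x y : K).

Lemma image_subring A : subring A -> A `<=` V -> subring (pi @` A).
Proof.
move=> hA sAV; apply/subringP; split.
- by exists 1 => //; apply: subring1.
- move=> _ _ [x Ax <-] [y Ay <-]; exists (x - y); first exact: subringB.
  by rewrite piB // in_setE; apply: sAV.
- move=> _ _ [x Ax <-] [y Ay <-]; exists (x * y); first exact: subringM.
  by rewrite piM // in_setE; apply: sAV.
Qed.

Lemma image_mem A x :
  subring A -> A `<=` V -> M `<=` A -> V x -> (pi @` A) (pi x) -> A x.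
Proof.
move=> hA sAV sMA Vx [a Aa e]; have Va := sAV _ Aa.
rewrite -(subrK a x); apply: subringD => //; apply: sMA.
by apply/(pi0 (subringB hV Vx Va)); rewrite piB ?in_setE // e subrr.
Qed.

Lemma adjoin_image A x y : subring A -> A `<=` V -> M `<=` A -> V x -> V y ->
  adjoin (pi @` A) (pi x) (pi y) <-> adjoin A x y.
Proof.
move=> hA sAV sMA Vx Vy.
have hAx := adjoin_subring x hA; have sAxV := adjoin_min hV sAV Vx.
have sAAx := @adjoin_sub _ A x hA.
have hpA := image_subring hA sAV; split=> [h|Axy].
  apply: image_mem => //; first exact: subset_trans sAAx.
  apply: adjoin_min h; first exact: image_subring.
    by move=> _ [a Aa <-]; exists a => //; apply: sAAx.
  by exists x => //; apply: adjoin_gen.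
have hB := adjoin_subring (pi x) hpA.
(* [B] is the preimage in [V] of the extension of residue rings; it is a ring containing [A] and x,
   hence A[x]. *)
pose B z := V z /\ adjoin (pi @` A) (pi x) (pi z).
suff : B y by case.
apply: (@adjoin_min _ A B x) Axy.
- apply/subringP; split.
  + by split; [exact: subring1|rewrite pi1; exact: subring1].
  + move=> u v [Vu Bu] [Vv Bv]; split; first exact: subringB.
    by rewrite piB ?in_setE //; apply: subringB.
  + move=> u v [Vu Bu] [Vv Bv]; split; first exact: subringM.
    by rewrite piM ?in_setE //; apply: subringM.
- move=> a Aa; split; first exact: sAV.
  by apply: adjoin_sub => //; exists a.
- by split=> //; apply: adjoin_gen.
Qed.

End Residue.

Section ValuativeOverring.
Variables (K : fieldType) (S V M E : set K).
Hypotheses (hS : subring S) (hV : subring V) (hE : subring E).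
Hypotheses (sSV : S `<=` V) (sSE : S `<=` E).
Hypothesis qfS : forall x, qf S x.
Hypothesis val : forall x : K, x != 0 -> V x \/ V x^-1.
Hypothesis VS : forall x, V x -> monic_root S x.
Hypotheses (MS : unique_maximal_ideal S M) (MV : unique_maximal_ideal V M).
Hypothesis valS : valuative S.

Let ME : M = valuation_nonunits V.
Proof.
have hN := valuation_nonunits_ideal val hV.
have [_ uN] : unique_maximal_ideal V (valuation_nonunits V).
  apply: unique_maximal_nonunits => //; first exact: valuation_nonunits_not1.
  by move=> x Vx nNx; apply: contrapT => h; apply: nNx; right.
exact: uN MV.1.
Qed.

Let sMS : M `<=` S.
Proof. by case: MS => -[[]]. Qed.

Let nV_inv x : ~ V x -> M x^-1.
Proof. by move=> nVx; rewrite ME; right; rewrite invrK. Qed.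

(** When x and 1/x are both outside [E], it turns out that [E] lies in [V] and x is in [V]. For C
    between E and E[x] and y in C outside E, [minimal_simple_extension] in V/M puts the residue of x
    in the ring generated by that of y; as M is inside [E], this lifts to x in E[y], inside C. *)
Lemma valuative_overring : valuative E.
Proof.
have triv x : E x -> no_ring_strictly_between E (adjoin E x).
  move=> Ex C hC sEC; rewrite (adjoin_id hE Ex) => sCE; left.
  by apply/seteqP.
move=> x _ x0.
have [Ex|nEx] := pselect (E x); first by left; apply: triv.
have [Ex'|nEx'] := pselect (E x^-1); first by right; apply: triv.
have sMV : M `<=` V by move=> m /sMS/sSV.
have sEV : E `<=` V.
  move=> y Ey; apply: contrapT => nVy.
  have y0 : y != 0.
    by apply/eqP => y0; apply: nVy; rewrite y0; apply: subring0.
  (* Each v in [V] is y (v y^-1), where y^-1 is in [M], so v y^-1 is in [M], inside [E]. *)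
  have sVE : V `<=` E.
    move=> v Vv; rewrite -[v](mulVKf y0); apply: subringM => //.
    apply/sSE/sMS; rewrite mulrC; have [[[_ _ _ Mmul] _ _] _] := MV.
    by apply: Mmul => //; apply: nV_inv.
  by case: (val x0) => /sVE.
have sME : M `<=` E by move=> m /sMS/sSE.
have Vx : V x by apply: contrapT => /nV_inv/sME.
left=> C hC sEC sCE; have [EC|nEC] := pselect (C `<=` E).
  by left; apply/seteqP.
right; apply/seteqP; split=> //; apply: (adjoin_min hC sEC).
have [y [Cy nEy]] : exists y, C y /\ ~ E y.
  apply: contrapT => h; apply: nEC => y Cy; apply: contrapT => nEy.
  by apply: h; exists y.
have Vy : V y by apply: (adjoin_min hV sEV Vx); apply: sCE.
have [[iM nMV _] _] := MV.
have M1 := ideal_not1 hV iM nMV.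
have Vinv z : V z -> ~ M z -> V z^-1.
  by move=> Vz; rewrite ME => nNz; apply: contrapT => h; apply: nNz; right.
have [L [pi [pi1 piB piM pi0 pisurj]]] := residue_fieldW hV iM M1 Vinv.
have piV z : V z -> ~ M z -> pi z^-1 = (pi z)^-1.
  move=> Vz nMz; have z0 : z != 0.
    by apply/eqP => z0; apply: nMz; rewrite z0; case: iM.
  have pz0 : pi z != 0 by apply/eqP => /pi0 h; apply: nMz; apply: h.
  apply: (mulfI pz0); rewrite -piM ?in_setE //; last exact: Vinv.
  by rewrite !mulfV.
have adjS := adjoin_image hV pi1 piB piM pi0 hS sSV sMS.
have adjE := adjoin_image hV pi1 piB piM pi0 hE sEV sME.
have hk := image_subring pi1 piB piM hS sSV.
have hF := image_subring pi1 piB piM hE sEV.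
have inv_in z : V z^-1 -> z != 0 -> adjoin S z z^-1.
  move=> /VS rz z0; rewrite -{1}[z]invrK.
  by apply: monic_root_adjoin_inv => //; rewrite invr_eq0.
have kalg (u : L) : u != 0 -> adjoin (pi @` S) u u^-1.
  have [z Vz <-] := pisurj u => pz0.
  have nMz : ~ M z by move=> Mz; case/eqP: pz0; apply/pi0.
  have z0 : z != 0 by apply/eqP => z0; apply: nMz; rewrite z0; case: iM.
  have Vz' := Vinv z Vz nMz.
  by rewrite -piV //; apply/adjS => //; apply: inv_in.
have kmin u v : adjoin (pi @` S) u v -> ~ (pi @` S) v -> adjoin (pi @` S) v u.
  have [z Vz <-] := pisurj u; have [w Vw <-] := pisurj v.
  move=> /(adjS _ _ Vz Vw) Szw nSw.
  have {}nSw : ~ S w by move=> Sw; apply: nSw; exists w.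
  apply/(adjS _ _ Vw Vz).
  have nSz : ~ S z by move=> Sz; apply: nSw; rewrite -(adjoin_id hS Sz).
  have nMz : ~ M z by move=> /sMS.
  have z0 : z != 0 by apply/eqP => z0; apply: nSz; rewrite z0; apply: subring0.
  have Vz' := Vinv z Vz nMz.
  have hSw := adjoin_subring w hS; have sSw := @adjoin_sub _ S w hS.
  have hSz := adjoin_subring z hS; have sSz := @adjoin_sub _ S z hS.
  have nSwS : adjoin S w <> S.
    by move=> e; apply: nSw; rewrite -e; apply: adjoin_gen.
  have [h|h] := valS (qfS z) z0.
    have [//|//|->] := h (adjoin S w) hSw sSw; first exact: adjoin_min.
    exact: adjoin_gen.
  (* z and 1/z are both in [V], hence integral over [S], so the two alternatives of [valuative] at z
     concern the same ring. *)
  have adjE' : adjoin S z^-1 = adjoin S z.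
    have hSz' := adjoin_subring z^-1 hS.
    apply/seteqP; split; apply: adjoin_min => //.
    - exact: inv_in.
    - exact: adjoin_sub.
    - by apply: monic_root_adjoin_inv => //; apply: VS.
  rewrite adjE' in h.
  have [//|//|->] := h (adjoin S w) hSw sSw; first exact: adjoin_min.
  exact: adjoin_gen.
have skF : pi @` S `<=` pi @` E.
  by move=> _ [s Ss <-]; exists s => //; apply: sSE.
have : adjoin (pi @` E) (pi y) (pi x).
  apply: (minimal_simple_extension hk kalg kmin hF skF).
    by apply/adjE => //; apply: sCE.
  by move=> /(image_mem hV piB pi0 hE sEV sME Vy).
move/(adjE _ _ Vy Vx); exact: (adjoin_min hC sEC Cy).
Qed.

End ValuativeOverring.

(** * The fraction field and integral closure of an abstract domain, and the equivalence *)

Lemma subring_in_frac (R : idomainType) : subring (in_frac R).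
Proof.
apply/subringP; split; first by exists 1; rewrite ?tofrac1.
- by move=> _ _ [a _ <-] [b _ <-]; exists (a - b); rewrite ?tofracB.
- by move=> _ _ [a _ <-] [b _ <-]; exists (a * b); rewrite ?tofracM.
Qed.

Lemma qf_in_frac (R : idomainType) (x : {fraction R}) : qf (in_frac R) x.
Proof.
elim/quotW: x => r.
exists (tofrac \n_r), (tofrac \d_r); split; [by eexists|by eexists| |].
  by rewrite tofrac_eq0 denom_ratioP.
have d0 : tofrac \d_r != 0 by rewrite tofrac_eq0 denom_ratioP.
apply: (mulIf d0); rewrite divfK //.
(* With the denominator cleared, the claim is an equality of classes of pairs, settled by cross
   multiplication. *)
unlock FracField.tofrac; rewrite -[LHS]FracField.pi_mul.
apply/eqmodP; rewrite /= FracField.equivfE.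
rewrite !numden_Ratio ?mulf_neq0 ?oner_neq0 ?denom_ratioP //.
by rewrite !mulr1 mulrC.
Qed.

Lemma integral_closureE (R : idomainType) (x : {fraction R}) :
  integral_closure R x <-> monic_root (in_frac R) x.
Proof.
split=> [[p mp rp]|[p [mp Dp rp]]].
  exists (map_poly (@tofrac R) p); split=> //; first exact: monic_map.
  by move=> i; rewrite coef_map; eexists.
have /choice[s hs] : forall i, exists a : R, tofrac a = p`_i.
  by move=> i; have [a _ e] := Dp i; exists a.
have pE : map_poly (@tofrac R) (\poly_(i < size p) s i) = p.
  apply/polyP => i; rewrite coef_map coef_poly; case: ltnP => [_|h]; first exact: hs.
  by rewrite raddf0 nth_default.
exists (\poly_(i < size p) s i); last by rewrite pE.
have p0 : (0 < size p)%N by rewrite size_poly_gt0 monic_neq0.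
(* Injectivity of [tofrac] makes the lifted leading coefficient 1, so the lifted polynomial stays
   monic. *)
have e : s (size p).-1 = 1.
  by apply/eqP; rewrite -tofrac_eq hs tofrac1 -lead_coefE -monicE.
rewrite monicE lead_coef_poly // e //; exact: oner_neq0.
Qed.

Lemma integral_closure_subring (R : idomainType) : subring (integral_closure R).
Proof.
apply/subringP; split; first exact: integral1.
- by move=> x y; apply: integral_sub.
- by move=> x y; apply: integral_mul.
Qed.

Lemma integral_closure_closed (R : idomainType) (x : {fraction R}) :
  monic_root (integral_closure R) x -> integral_closure R x.
Proof.
move=> [p [mp Vp rp]]; apply: (integral_root_monic mp rp) => c.
by move=> /(nthP 0)[i _ <-]; apply: Vp.
Qed.

Theorem theorem2p14 (R : idomainType)
    (hmax : maximal_non_pseudo_valuation_subring (in_frac R)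
              [set: {fraction R}])
    (hloc : local_ring (in_frac R)) :
  maximal_non_valuative (in_frac R) <->
  (~ valuative (in_frac R) /\
   exists S : set {fraction R},
     [/\ unique_minimal_overring (in_frac R) S,
         valuative S,
         pseudo_valuation S
       & associated_valuation_overring S (integral_closure R)]).
Proof.
have hD := subring_in_frac R; have hV := integral_closure_subring R.
have [_ _ _ npv hpv] := hmax.
have {}hpv E : subring E -> in_frac R `<=` E -> E <> in_frac R ->
    pseudo_valuation E.
  by move=> hE sDE nE; apply: hpv.
split=> [[nval hval]|[nval [S [[pS minS] valS _ aS]]]]; last first.
  (* (ii) implies (i): a proper overring contains [S] by minimality, and valuativity passes from [S]
     to it. *)
  have [[[hS sDS _] _] [[_ sSV _] vV [M [MS MV]]]] := (pS, aS).
  split=> // E pE; have [[hE _ _] _] := pE.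
  have qfS x : qf S x by apply: qf_sub sDS (qf_in_frac x).
  apply: (valuative_overring hS hV hE sSV (minS E pE) qfS _ _ MS MV valS).
    by move=> x; apply: vV; apply: qf_sub sSV (qfS x).
  by move=> x /integral_closureE; apply: monic_root_sub.
(* (i) implies (ii): [S], as a proper overring, is valuative by (i) and pseudo-valuation by
   [hpv]. *)
split=> //; have [S [uS aS]] := unique_minimal_overring_of_closure
  hD hV (@qf_in_frac R) (@integral_closureE R) (@integral_closure_closed R)
  hpv npv hloc.
have [pS _] := uS; exists S; split=> //; first exact: hval.
by have [[hS sDS _] nS] := pS; apply: hpv.
Qed.
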